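(* Let $V$ be an $\ell$-Volterra quadratic stochastic operator on $S^{m-1}$ with associated coefficients $a_{ki}$. Suppose there exists $k_0\in\{1,\dots,\ell\}$ such that $a_{k_0i}\le 0$ for every $i\in E$. Let $p=(p_1,\dots,p_\ell)\in P_0$, where $$P_0=\Big\{p=(p_1,\dots,p_\ell)\in S^{\ell-1}:\ \sum_{k=1}^{\ell}a_{ki}p_k\le 0\ \text{ for every } i\in E\Big\}.$$ Then $\varphi_p(x)=x_1^{p_1}\cdots x_\ell^{p_\ell}$ is a Lyapunov function for $V$.
   Context: Let $E=\{1,\dots,m\}$ and $S^{n-1}=\{x\in\mathbb{R}^n: x_i\ge 0,\ \sum_{i=1}^n x_i=1\}$, $\mathrm{int}\,S^{m-1}=\{x\in S^{m-1}:\prod_{i=1}^m x_i>0\}$. A quadratic stochastic operator is a map $V:S^{m-1}\to S^{m-1}$, $V(x)_k=\sum_{i,j=1}^m P_{ij,k}x_ix_j$, where $P_{ij,k}\ge 0$, $P_{ij,k}=P_{ji,k}$, $\sum_{k=1}^m P_{ij,k}=1$ for all $i,j,k\in E$. For a fixed $\ell\in E$, $V$ is called $\ell$-Volterra if (i) $P_{ij,k}=0$ whenever $k\in\{1,\dots,\ell\}$, $i,j\in E$ and $k\notin\{i,j\}$; and (ii) for every $k\in\{\ell+1,\dots,m\}$ there is at least one pair $(i,j)$ with $i\ne k$, $j\ne k$ and $P_{ij,k}>0$. Its associated coefficients are $a_{ki}=2P_{ik,k}-1$ for $k\ne i$ and $a_{kk}=P_{kk,k}-1$ ($k,i\in E$).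 For $k\le\ell$ one then has $V(x)_k=x_k(1+\sum_{i=1}^m a_{ki}x_i)$. The trajectory of $x^0\in S^{m-1}$ is $x^{(0)}=x^0$, $x^{(n+1)}=V(x^{(n)})$. A continuous function $\varphi:\mathrm{int}\,S^{m-1}\to\mathbb{R}$ is called a Lyapunov function for $V$ if $\lim_{n\to\infty}\varphi(x^{(n)})$ exists (as a real number) for any initial point $x^0\in S^{m-1}$. Here $\varphi_p$ is extended from $\mathrm{int}\,S^{m-1}$ to $S^{m-1}$ by the same formula with the convention $0^0=1$. *)

(* Defs.v *)
From HB Require Import structures.
From mathcomp Require Import all_boot all_order all_algebra.
From mathcomp Require Import all_classical all_reals all_analysis.

Set Implicit Arguments.
Unset Strict Implicit.
Unset Printing Implicit Defensive.

Import Order.TTheory GRing.Theory Num.Theory.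
Import numFieldNormedType.Exports.
Local Open Scope classical_set_scope.
Local Open Scope ring_scope.

(* Indices are 0-based: E = {1, ..., m} becomes 'I_m, and
   k in {1, ..., l} becomes either k : 'I_m with k < l, or k : 'I_l embedded
   in 'I_m by widen_ord. *)

Definition simplex (R : realType) (n : nat) : set 'rV[R]_n :=
  [set x | (forall i, 0 <= x 0 i) /\ \sum_(i < n) x 0 i = 1].

Definition int_simplex (R : realType) (n : nat) : set 'rV[R]_n :=
  [set x | simplex x /\ 0 < \prod_(i < n) x 0 i].

Definition qso_coefs (R : realType) (m : nat)
    (P : 'I_m -> 'I_m -> 'I_m -> R) : Prop :=
  [/\ forall i j k, 0 <= P i j k,
      forall i j k, P i j k = P j i k
    & forall i j, \sum_(k < m) P i j k = 1].

(* Defined on all of R^m; only its values on the simplex, which it preserves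
   (qso_simplex), are meaningful. *)
Definition qso (R : realType) (m : nat) (P : 'I_m -> 'I_m -> 'I_m -> R)
    (x : 'rV[R]_m) : 'rV[R]_m :=
  \row_k \sum_(i < m) \sum_(j < m) P i j k * x 0 i * x 0 j.

Lemma qso_simplex (R : realType) (m : nat) (P : 'I_m -> 'I_m -> 'I_m -> R)
    (x : 'rV[R]_m) :
  qso_coefs P -> simplex x -> simplex (qso P x).
Proof.
move=> [P0 _ P1] [x0 x1]; split=> [k|].
  rewrite mxE; apply: sumr_ge0 => i _; apply: sumr_ge0 => j _.
  by rewrite !mulr_ge0.
under eq_bigr do rewrite mxE.
rewrite exchange_big /= -[RHS]x1; apply: eq_bigr => i _.
rewrite exchange_big /= -[RHS]mulr1 -x1 mulr_sumr; apply: eq_bigr => j _.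
by rewrite -!mulr_suml P1 mul1r.
Qed.

Definition l_volterra (R : realType) (m : nat) (l : nat)
    (P : 'I_m -> 'I_m -> 'I_m -> R) : Prop :=
  (forall k i j : 'I_m, (k < l)%N -> k != i -> k != j -> P i j k = 0) /\
  (forall k : 'I_m, (l <= k)%N ->
     exists i j : 'I_m, [/\ i != k, j != k & 0 < P i j k]).

Definition volterra_coef (R : realType) (m : nat)
    (P : 'I_m -> 'I_m -> 'I_m -> R) (k i : 'I_m) : R :=
  if k == i then P k k k - 1 else 2 * P i k k - 1.

Definition P0 (R : realType) (m l : nat) (lm : (l <= m)%N)
    (a : 'I_m -> 'I_m -> R) : set 'rV[R]_l :=
  [set p | simplex p /\
    forall i : 'I_m, \sum_(k < l) a (widen_ord lm k) i * p 0 k <= 0].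

(* powR satisfies 0 `^ 0 = 1 and 0 `^ r = 0 for r != 0, so this formula also
   gives the extension to the whole simplex with the convention 0^0 = 1. *)
Definition phi (R : realType) (m l : nat) (lm : (l <= m)%N) (p : 'rV[R]_l)
    (x : 'rV[R]_m) : R :=
  \prod_(k < l) (x 0 (widen_ord lm k)) `^ (p 0 k).

(* f : int S^(m-1) -> R is represented by a total function; its values on the
   boundary of the simplex, which matter in the second clause only, are those
   of the chosen extension of f. *)
Definition lyapunov (R : realType) (m : nat) (V : 'rV[R]_m -> 'rV[R]_m)
    (f : 'rV[R]_m -> R) : Prop :=
  {within @int_simplex R m, continuous f} /\
  forall x0, simplex x0 ->
    exists r : R, (fun n : nat => f (iter n V x0)) @ \oo --> r.

(* Main.v *)
Require Import Defs.
From HB Require Import structures.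
From mathcomp Require Import all_boot all_order all_algebra.
From mathcomp Require Import all_classical all_reals all_analysis.
From mathcomp Require Import ring.

Set Implicit Arguments.
Unset Strict Implicit.
Unset Printing Implicit Defensive.

Import Order.TTheory GRing.Theory Num.Theory.
Import numFieldNormedType.Exports.
Local Open Scope classical_set_scope.
Local Open Scope ring_scope.

(** Along an orbit, a coordinate [k < l] is multiplied at each step by the
    growth factor [1 + s_k(x)], where [s_k(x) = \sum_i a_(k i) x_i]; this
    factor is a nonnegative number because [1 + a_(k i)] is a nonnegative
    multiple of a coefficient of the operator. Consequently [phi] is multiplied
    by [\prod_k (1 + s_k(x)) ^ p_k], and the inequality [1 + s <= exp s] bounds
    this product by [exp (\sum_k p_k s_k(x))]. Exchanging the two sums, the
    exponent is [\sum_i (\sum_k a_(k i) p_k) x_i], which is nonpositive exactly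
    because [p] belongs to [P0]. So [phi] is nonincreasing along every
    orbit in the simplex, boundary included ([phi_qso_le]); being nonnegative,
    it converges. Using the exponential bound instead of the weighted inequality
    between arithmetic and geometric means treats vanishing factors and
    vanishing exponents uniformly. *)

Lemma int_simplex_gt0 (R : realType) (m : nat) (x : 'rV[R]_m) (k : 'I_m) :
  int_simplex x -> 0 < x 0 k.
Proof.
move=> [[x_ge0 _] prod_gt0]; rewrite lt0r x_ge0 andbT.
by move: (lt0r_neq0 prod_gt0) => /prodf_neq0; apply.
Qed.

Lemma powR_continuous (R : realType) (r a : R) :
  0 < a -> {for a, continuous (fun y : R => y `^ r)}.
Proof.
move=> a_gt0; apply: differentiable_continuous; apply/derivable1_diffP.
by apply: derivable_powR; rewrite in_itv/= a_gt0.
Qed.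

(** Real powers are continuous away from zero, and the coordinates do not
    vanish in the interior of the simplex. *)
Lemma phi_continuous (R : realType) (m l : nat) (lm : (l <= m)%N)
    (p : 'rV[R]_l) : {within @int_simplex R m, continuous (phi lm p)}.
Proof.
apply: continuous_in_subspaceT => x /[!inE] x_int.
apply: (@cvg_big _ _ _ _ _ mul_continuous _ (nbhs x)) => k _.
apply: (@continuous_comp _ _ _ (fun y : 'rV[R]_m => y 0 (widen_ord lm k))
          (fun y : R => y `^ p 0 k)); first exact: coord_continuous.
by apply: powR_continuous; exact: int_simplex_gt0.
Qed.

(** The [r]-th power of [y <= expR (y - 1)]. With [0 ^ 0 = 1], the cases
    [y = 0] and [r = 0] need no separate treatment. *)
Lemma powR_le_expR (R : realType) (y r : R) :
  0 <= y -> 0 <= r -> y `^ r <= expR ((y - 1) * r).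
Proof.
move=> y_ge0 r_ge0; rewrite expRM.
apply: ge0_ler_powR; rewrite ?nnegrE ?expR_ge0//.
by rewrite (le_trans _ (expR_ge1Dx _))// addrC subrK.
Qed.

Lemma volterra_coef1D_ge0 (R : realType) (m : nat) (P : 'I_m -> 'I_m -> 'I_m -> R)
    (k i : 'I_m) : qso_coefs P -> 0 <= 1 + volterra_coef P k i.
Proof.
move=> [P_ge0 _ _]; rewrite /volterra_coef.
by case: ifP => _; rewrite addrC subrK ?mulr_ge0.
Qed.

Lemma growth_factorE (R : realType) (m : nat) (a : 'I_m -> R) (x : 'rV[R]_m) :
  simplex x -> 1 + \sum_i a i * x 0 i = \sum_i (1 + a i) * x 0 i.
Proof.
move=> [_ x_sum]; under [RHS]eq_bigr do rewrite mulrDl mul1r.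
by rewrite big_split/= x_sum.
Qed.

Lemma growth_factor_ge0 (R : realType) (m : nat)
    (P : 'I_m -> 'I_m -> 'I_m -> R) (x : 'rV[R]_m) (k : 'I_m) :
  qso_coefs P -> simplex x -> 0 <= 1 + \sum_i volterra_coef P k i * x 0 i.
Proof.
move=> hP hx; rewrite growth_factorE//; apply: sumr_ge0 => i _.
by rewrite mulr_ge0 ?volterra_coef1D_ge0//; case: hx.
Qed.

(** Only the pairs [(i, j)] with [k = i] or [k = j] contribute to a Volterra
    coordinate, so [x_k] factors out; each [i != k] is counted twice, whence
    the factor 2 in the associated coefficients. *)
Lemma qso_volterraE (R : realType) (m l : nat) (P : 'I_m -> 'I_m -> 'I_m -> R)
    (x : 'rV[R]_m) (k : 'I_m) :
  qso_coefs P -> l_volterra l P -> simplex x -> (k < l)%N ->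
  qso P x 0 k = x 0 k * (1 + \sum_i volterra_coef P k i * x 0 i).
Proof.
move=> [_ P_sym _] [P_volterra _] hx kl; rewrite growth_factorE// mxE.
rewrite (bigD1 k)//= [X in X + _](bigD1 k)//=.
have -> : \sum_(i < m | i != k) \sum_(j < m) P i j k * x 0 i * x 0 j =
          \sum_(i < m | i != k) P i k k * x 0 i * x 0 k.
  apply: eq_bigr => i ik; rewrite (bigD1 k)//= big1 ?addr0// => j jk.
  by rewrite P_volterra ?mul0r// eq_sym.
rewrite [in RHS](bigD1 k)//= mulrDr -addrA; congr (_ + _).
  by rewrite /volterra_coef eqxx; ring.
rewrite -big_split mulr_sumr; apply: eq_bigr => i ik.
by rewrite /volterra_coef eq_sym (negPf ik) (P_sym k i k)/=; ring.
Qed.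

Lemma phi_ge0 (R : realType) (m l : nat) (lm : (l <= m)%N) (p : 'rV[R]_l)
    (x : 'rV[R]_m) : 0 <= phi lm p x.
Proof. by apply: prodr_ge0 => k _; exact: powR_ge0. Qed.

(** The condition defining [P0] is on the columns of the matrix of
    coefficients; exchanging the sums turns it into the nonpositivity of the
    weighted exponents of the growth factors. *)
Lemma P0_weighted_growth_le0 (R : realType) (m l : nat) (lm : (l <= m)%N)
    (a : 'I_m -> 'I_m -> R) (p : 'rV[R]_l) (x : 'rV[R]_m) :
  P0 lm a p -> simplex x ->
  \sum_(k < l) (\sum_i a (widen_ord lm k) i * x 0 i) * p 0 k <= 0.
Proof.
move=> [_ p_le0] [x_ge0 _].
under eq_bigr do rewrite mulr_suml.
rewrite exchange_big/=; apply: sumr_le0 => i _.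
under eq_bigr do rewrite mulrAC.
by rewrite -mulr_suml mulr_le0_ge0.
Qed.

(** The growth factors multiply [phi] by a number bounded by the exponential
    of a nonpositive weighted sum. *)
Lemma phi_qso_le (R : realType) (m l : nat) (lm : (l <= m)%N)
    (P : 'I_m -> 'I_m -> 'I_m -> R) (p : 'rV[R]_l) (x : 'rV[R]_m) :
  qso_coefs P -> l_volterra l P -> P0 lm (volterra_coef P) p -> simplex x ->
  phi lm p (qso P x) <= phi lm p x.
Proof.
move=> hP hV hp hx; have [[p_ge0 _] _] := hp.
have -> : phi lm p (qso P x) = phi lm p x *
    \prod_(k < l) (1 + \sum_i volterra_coef P (widen_ord lm k) i * x 0 i)
      `^ p 0 k.
  rewrite /phi -big_split/=; apply: eq_bigr => k _.
  by rewrite (qso_volterraE hP hV hx)//= powRM ?growth_factor_ge0//; case: hx.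
rewrite ler_piMr ?phi_ge0//.
apply: (@le_trans _ _ (\prod_(k < l)
    expR ((\sum_i volterra_coef P (widen_ord lm k) i * x 0 i) * p 0 k))).
  apply: ler_prod => k _; rewrite powR_ge0/=.
  apply: le_trans (powR_le_expR _ (p_ge0 k)) _; first exact: growth_factor_ge0.
  by rewrite addrAC subrr add0r.
by rewrite -expR_sum expR_le1 P0_weighted_growth_le0.
Qed.

Lemma iter_qso_simplex (R : realType) (m : nat)
    (P : 'I_m -> 'I_m -> 'I_m -> R) (x : 'rV[R]_m) (n : nat) :
  qso_coefs P -> simplex x -> simplex (iter n (qso P) x).
Proof. by move=> hP hx; elim: n => //= n; exact: qso_simplex. Qed.

Theorem theorem1 (R : realType) (m l : nat) (l_gt0 : (0 < l)%N)
    (lm : (l <= m)%N) (P : 'I_m -> 'I_m -> 'I_m -> R)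
    (hP : qso_coefs P) (hV : l_volterra l P)
    (hk0 : exists k0 : 'I_l, forall i : 'I_m,
       volterra_coef P (widen_ord lm k0) i <= 0)
    (p : 'rV[R]_l) (hp : P0 lm (volterra_coef P) p) :
  lyapunov (qso P) (phi lm p).
Proof.
split; first exact: phi_continuous.
move=> x0 hx0; exists (limn (fun n => phi lm p (iter n (qso P) x0))).
apply: nonincreasing_is_cvgn.
  apply/nonincreasing_seqP => n /=.
  by apply: phi_qso_le => //; exact: iter_qso_simplex.
by exists 0 => _ [n _ <-]; exact: phi_ge0.
Qed.
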